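(* Let $L$ be a $\hat{\mathfrak g}$-module such that for every $v\in L$ one has $(\mathfrak g\otimes t^k\mathbb C[t])v=0$ for all sufficiently large $k\in\mathbb N$. Let $m\in\mathbb N$, let $\mathbf a=(a_1,\dots,a_m)\in\mathbb C^m$ have nonzero, pairwise distinct entries, and let $\boldsymbol\lambda=(\lambda_1,\dots,\lambda_m)\in(\mathfrak h^* )^m$. Then every $\hat{\mathfrak g}$-submodule of $E(\boldsymbol\lambda,\mathbf a)\otimes L$ is of the form $E(\boldsymbol\lambda,\mathbf a)\otimes N$ for some $\hat{\mathfrak g}$-submodule $N$ of $L$.
   Context: $\mathfrak g$ is a finite-dimensional simple Lie algebra over $\mathbb C$ with Cartan subalgebra $\mathfrak h$, a fixed base of its root system, and triangular decomposition $\mathfrak g=\mathfrak n_-\oplus\mathfrak h\oplus\mathfrak n_+$. $\hat{\mathfrak g}=\mathfrak g\otimes\mathbb C[t,t^{-1}]\oplus\mathbb CK$ is the Lie algebra with $K$ central and $[x\otimes t^m,y\otimes t^n]=[x,y]\otimes t^{m+n}+(x|y)\,m\,\delta_{m+n,0}K$, where $(\cdot|\cdot)$ is the Killing form of $\mathfrak g$. For $\lambda\in\mathfrak h^*$, $V(\lambda)$ is the irreducible highest weight $\mathfrak g$-module of highest weight $\lambda$ (possibly infinite-dimensional). For $\boldsymbol\lambda=(\lambda_1,\dots,\lambda_m)\in(\mathfrak h^* )^m$ and $\mathbf a=(a_1,\dots,a_m)$ with nonzero pairwise distinct entries, the evaluation module $E(\boldsymbol\lambda,\mathbf a)$ is the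 $\hat{\mathfrak g}$-module $V(\lambda_1)\otimes\cdots\otimes V(\lambda_m)$ with $K$ acting as $0$ and $(x\otimes t^k)(v_1\otimes\cdots\otimes v_m)=\sum_{i=1}^m a_i^k\,v_1\otimes\cdots\otimes xv_i\otimes\cdots\otimes v_m$ for $x\in\mathfrak g$, $k\in\mathbb Z$. $\mathbb N$ denotes the positive integers. *)

(* Defs.v *)
From HB Require Import structures.
From mathcomp Require Import all_boot all_order all_algebra.
From mathcomp Require Import finmap.
From mathcomp Require Import boolp classical_sets functions cardinality fsbigop.
From mathcomp Require Import reals.
From mathcomp Require Import complex.
From mathcomp Require Import zify.

Set Implicit Arguments.
Unset Strict Implicit.
Unset Printing Implicit Defensive.

Import Order.TTheory GRing.Theory Num.Theory.

Local Open Scope classical_set_scope.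
Local Open Scope ring_scope.

HB.mixin Record isLieAlgebra (F : fieldType) V of GRing.Lmodule F V := {
  lie : V -> V -> V;
  lie_linearl : forall z, linear (fun x => lie x z);
  lie_linearr : forall z, linear (lie z);
  liexx : forall x, lie x x = 0;
  lie_jacobi : forall x y z,
    lie x (lie y z) + lie y (lie z x) + lie z (lie x y) = 0
}.

#[short(type="lieAlgType")]
HB.structure Definition LieAlgebra (F : fieldType) :=
  { V of GRing.Lmodule F V & isLieAlgebra F V }.

#[short(type="finLieAlgType")]
HB.structure Definition FinLieAlgebra (F : fieldType) :=
  { V of Vector F V & isLieAlgebra F V }.

Notation "[lie x , y ]" := (lie x y) (format "[lie  x ,  y ]") : ring_scope.

HB.mixin Record isLieModule (F : fieldType) (g : lieAlgType F) V
    of GRing.Lmodule F V := {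
  lieact : g -> V -> V;
  lieact_linearl : forall v, linear (fun x => lieact x v);
  lieact_linearr : forall x, linear (lieact x);
  lieact_lie : forall x y v,
    lieact [lie x, y] v = lieact x (lieact y v) - lieact y (lieact x v)
}.

#[short(type="lieModType")]
HB.structure Definition LieModule (F : fieldType) (g : lieAlgType F) :=
  { V of GRing.Lmodule F V & isLieModule F g V }.

Lemma linear_fun0 (F : fieldType) (U W : lmodType F) (L : U -> W) :
  linear L -> L 0 = 0.
Proof. by move=> linL; rewrite -(addNr 0) -scaleN1r linL scaleN1r addNr. Qed.

Section LieTheory.
Variables (F : fieldType) (g : lieAlgType F).
Implicit Types x y z : g.

HB.instance Definition _ x :=
  GRing.isLinear.Build F g g _ (lie x) (lie_linearr x).

Lemma lieDl z x y : [lie x + y, z] = [lie x, z] + [lie y, z].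
Proof. by have := lie_linearl z 1 x y; rewrite !scale1r. Qed.

Lemma lie0l x : [lie 0, x] = 0.
Proof. exact: linear_fun0 (lie_linearl x). Qed.

Lemma lie_anti x y : [lie x, y] = - [lie y, x].
Proof.
apply/eqP; rewrite -addr_eq0; apply/eqP.
by have := liexx (x + y); rewrite lieDl !raddfD /= !liexx add0r addr0.
Qed.

End LieTheory.

Section Subspaces.
Variables (F : fieldType) (V : lmodType F).

Definition is_subspace (S : set V) : Prop :=
  S 0 /\ forall a x y, S x -> S y -> S (a *: x + y).

Definition lspan (S : set V) : set V :=
  [set v | forall W : set V, is_subspace W -> S `<=` W -> W v].

End Subspaces.

Definition is_submodule (F : fieldType) (g : lieAlgType F) (V : lieModType g)
    (S : set V) : Prop :=
  is_subspace S /\ forall (x : g) v, S v -> S (lieact x v).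

Definition irreducible_module (F : fieldType) (g : lieAlgType F)
    (V : lieModType g) : Prop :=
  (exists v : V, v != 0) /\
  forall S : set V, is_submodule S -> S = [set 0] \/ S = [set: V].

Section FiniteDimensional.
Variables (F : fieldType) (g : finLieAlgType F).
Implicit Types (x y z : g) (U V h : {vspace g}).

Definition ad x : 'End(g) := linfun (lie x).

Definition lfun_trace (f : 'End(g)) : F :=
  \sum_(i < \dim {:g}) coord (vbasis {:g}) i (f (vbasis {:g})`_i).

Definition killing x y : F := lfun_trace (ad x \o ad y)%VF.

Definition is_ideal V : Prop := forall x y, y \in V -> [lie x, y] \in V.

Definition simple_lie : Prop :=
  (exists x y, [lie x, y] != 0) /\
  forall V, is_ideal V -> V = 0%VS \/ V = fullv.

Definition lie_vs U V : {vspace g} :=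
  <<[seq [lie x, y] | x <- vbasis U, y <- vbasis V]>>%VS.

Definition lower_central h (n : nat) : {vspace g} := iter n (lie_vs h) h.

Definition cartan_subalgebra h : Prop :=
  [/\ (lie_vs h h <= h)%VS,
      (exists n, lower_central h n = 0%VS)
    & forall x, (forall y, y \in h -> [lie x, y] \in h) -> x \in h].

Definition hdual h := 'Hom(subvs_of h, F^o).

Section Roots.
Variable h : {vspace g}.
Implicit Types (al : hdual h) (D : seq (hdual h)).

Definition root_space al : set g :=
  [set x | forall t : subvs_of h, [lie vsval t, x] = (al t : F) *: x].

Definition is_root al : Prop := al != 0 /\ exists2 x, root_space al x & x != 0.

Definition nat_comb D al : Prop :=
  exists c : nat -> nat, al = \sum_(i < size D) D`_i *+ c i.

(* Linear independence is required over [F]. The roots of a simple complex Lie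
   algebra lie in a rational form of the dual of [h], so this agrees with
   independence over the reals. *)
Definition root_base D : Prop :=
  [/\ free D, (forall al, al \in D -> is_root al)
    & forall al, is_root al -> nat_comb D al \/ nat_comb D (- al)].

Definition nplus D : set g :=
  lspan [set x | exists al, [/\ is_root al, nat_comb D al & root_space al x]].

Definition highest_weight_vector D (la : hdual h) (V : lieModType g) (v : V) :
    Prop :=
  [/\ v != 0, (forall x, nplus D x -> lieact x v = 0)
    & forall t : subvs_of h, lieact (vsval t) v = (la t : F) *: v].

Definition irreducible_highest_weight D (la : hdual h) (V : lieModType g) :
    Prop :=
  irreducible_module V /\
  exists v : V, highest_weight_vector D la v /\
    forall S : set V, is_submodule S -> S v -> S = [set: V].

End Roots.

End FiniteDimensional.

Section KillingTheory.
Variables (F : fieldType) (g : finLieAlgType F).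
Implicit Types (x y z : g) (f : 'End(g)).

Lemma lfun_traceC f1 f2 : lfun_trace (f1 \o f2)%VF = lfun_trace (f2 \o f1)%VF.
Proof.
have E (f f' : 'End(g)) : lfun_trace (f \o f')%VF = \sum_(i < \dim {:g})
    \sum_(j < \dim {:g}) coord (vbasis {:g}) j (f' (vbasis {:g})`_i) *
                         coord (vbasis {:g}) i (f (vbasis {:g})`_j).
  apply: eq_bigr => i _; rewrite comp_lfunE.
  rewrite {1}[f' _](coord_vbasis (memvf _)) linear_sum linear_sum /=.
  by apply: eq_bigr => j _; rewrite linearZ linearZ.
rewrite !E exchange_big; apply: eq_bigr => i _; apply: eq_bigr => j _.
exact: mulrC.
Qed.

Lemma lfun_trace_linear : scalar (@lfun_trace F g).
Proof.
move=> a f1 f2; rewrite /lfun_trace mulr_sumr -big_split /=.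
by apply: eq_bigr => i _; rewrite add_lfunE scale_lfunE linearP.
Qed.

Lemma adE x y : ad x y = [lie x, y].
Proof. by rewrite lfunE. Qed.

Lemma ad_linear : linear (@ad F g).
Proof.
move=> a x y; apply/lfunP => z.
by rewrite add_lfunE scale_lfunE !adE; exact: lie_linearl.
Qed.

Lemma ad_lie x y : ad [lie x, y] = ((ad x \o ad y) - (ad y \o ad x))%VF.
Proof.
apply/lfunP => z; rewrite add_lfunE opp_lfunE !comp_lfunE !adE.
have := lie_jacobi x y z.
rewrite [in X in X -> _](lie_anti z x) raddfN /= (lie_anti z [lie x, y]).
by move/eqP; rewrite subr_eq0 => /eqP ->.
Qed.

Lemma killingC x y : killing x y = killing y x.
Proof. exact: lfun_traceC. Qed.

Lemma killing_linearl z : scalar (fun x : g => killing x z).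
Proof.
move=> a x y; rewrite /killing ad_linear comp_lfunDl -comp_lfunZl.
exact: lfun_trace_linear.
Qed.

Lemma killing0l x : killing 0 x = 0.
Proof. exact: (linear_fun0 (W := F^o) (@killing_linearl x)). Qed.

Lemma killing_linearr z : scalar (fun x : g => killing z x).
Proof. by move=> a x y; rewrite !(killingC z) killing_linearl. Qed.

Lemma killing_lie x y z : killing [lie x, y] z = killing x [lie y, z].
Proof.
have B (f1 f2 : 'End(g)) : lfun_trace (f1 - f2)%VF = lfun_trace f1 - lfun_trace f2.
  by rewrite addrC -scaleN1r lfun_trace_linear mulN1r addrC.
rewrite /killing !ad_lie comp_lfunDl comp_lfunDr comp_lfunNl comp_lfunNr !B.
congr (_ - _); first by rewrite comp_lfunA.
by rewrite -comp_lfunA lfun_traceC -comp_lfunA.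
Qed.

End KillingTheory.

Section Loop.
Variables (F : fieldType) (V : lmodType F).

Definition fin_supp : {pred int -> V} :=
  [pred f : int -> V | `[< finite_set [set n | f n != 0] >]].

Lemma fin_supp_submod : submod_closed fin_supp.
Proof.
split=> [|a f1 f2 /asboolP s1 /asboolP s2]; apply/asboolP.
  by rewrite (_ : [set n | _] = set0) // -subset0 => n /=; rewrite eqxx.
apply: (@sub_finite_set _ _ ([set n | f1 n != 0] `|` [set n | f2 n != 0])).
  move=> n /=; rewrite -[(_ + _) n]/(a *: f1 n + f2 n).
  case: (eqVneq (f1 n) 0) => [->|_]; last by left.
  by rewrite scaler0 add0r; right.
by rewrite finite_setU.
Qed.

HB.instance Definition _ :=
  GRing.isSubmodClosed.Build F (int -> V) fin_supp fin_supp_submod.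

(* [f : loop V] stands for the Laurent polynomial whose coefficient of [t^n]
   is [f n], so [loop V] is the tensor product of [V] with F[t, t^-1]. *)
Record loop := Loop { loopf :> int -> V; _ : loopf \in fin_supp }.

HB.instance Definition _ := [isSub for loopf].
HB.instance Definition _ := [Choice of loop by <:].
HB.instance Definition _ := [SubChoice_isSubLmodule of loop by <:].

Lemma loopP (f1 f2 : loop) : f1 =1 f2 -> f1 = f2.
Proof. by move=> f12; apply/val_inj/funext. Qed.

Lemma loop_linE a (f1 f2 : loop) n : (a *: f1 + f2) n = a *: f1 n + f2 n.
Proof. by []. Qed.

Lemma loop0E n : (0 : loop) n = 0.
Proof. by []. Qed.

Lemma loop_fin (f : loop) : finite_set [set n | f n != 0].
Proof. by case: f => f /= /asboolP. Qed.

Lemma mono_subproof (x : V) (m : int) :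
  (fun n : int => if n == m then x else 0) \in fin_supp.
Proof.
apply/asboolP/(@sub_finite_set _ _ [set m]) => [n /=|]; last exact: finite_set1.
by case: (n =P m) => //; rewrite eqxx.
Qed.

Definition mono (x : V) (m : int) : loop := Loop (mono_subproof x m).

Lemma monoE x m n : mono x m n = if n == m then x else 0.
Proof. by []. Qed.

Lemma mono_linear m : linear (mono^~ m).
Proof.
move=> a x y; apply: loopP => n; rewrite loop_linE !monoE.
by case: eqP; rewrite // scaler0 addr0.
Qed.

Lemma loop_sumE I (r : seq I) (P : pred I) (f : I -> loop) n :
  (\sum_(i <- r | P i) f i) n = \sum_(i <- r | P i) f i n.
Proof. by elim/big_rec2: _ => // i y1 y2 _ <-; rewrite -[f i in LHS]scale1r loop_linE scale1r. Qed.

Lemma loop_mono_sum (f : loop) :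
  f = \sum_(m <- fset_set [set n | f n != 0]) mono (f m) m.
Proof.
apply: loopP => n; rewrite loop_sumE.
have [fn0|fn0] := eqVneq (f n) 0.
  by rewrite fn0 big1 // => m _; rewrite monoE; case: eqP => // <-.
have nA : n \in fset_set [set n | f n != 0].
  by rewrite in_fset_set ?inE //; exact: loop_fin.
rewrite (big_fsetD1 n) // monoE eqxx big_seq big1 => [|m].
  by rewrite /= addr0.
by rewrite !inE monoE eq_sym => /andP[/negPf ->].
Qed.

End Loop.

Section Affine.
Variables (F : fieldType) (g : finLieAlgType F).
Implicit Types (f : loop g) (x y z : g).

Lemma fsum_fin (W : zmodType) (A : set int) (G : int -> W) : finite_set A ->
    (forall i, ~ A i -> G i = 0) ->
  \sum_(i \in [set: int]) G i = \sum_(i <- fset_set A) G i.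
Proof.
move=> finA G0; rewrite -fsbig_finite //; apply/esym/fsbig_widen => // i [_] /=.
exact: G0.
Qed.

Lemma fsum_linear (W : lmodType F) (A : set int) (a : F) (G H : int -> W) :
    finite_set A -> (forall i, ~ A i -> G i = 0) ->
    (forall i, ~ A i -> H i = 0) ->
  \sum_(i \in [set: int]) (a *: G i + H i) =
  a *: (\sum_(i \in [set: int]) G i) + \sum_(i \in [set: int]) H i.
Proof.
move=> finA G0 H0; rewrite !(fsum_fin finA) //.
  by rewrite scaler_sumr big_split.
by move=> i Ai; rewrite G0 // H0 // scaler0 addr0.
Qed.

Lemma loop_lie_subproof f1 f2 :
  (fun n : int => \sum_(i \in [set: int]) [lie f1 i, f2 (n - i)])
    \in @fin_supp F g.
Proof.
apply/asboolP; apply: sub_finite_set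
  (finite_image2 (fun i j => i + j) (loop_fin f1) (loop_fin f2)) => n /= sn.
apply: contrapT => nAB; case/eqP: sn; apply: fsbig1 => i _.
have [->|f1i] := eqVneq (f1 i) 0; first by rewrite lie0l.
have [->|f2i] := eqVneq (f2 (n - i)) 0; first by rewrite linear0.
by case: nAB; exists i => //; exists (n - i) => //; rewrite addrC subrK.
Qed.

Definition loop_lie f1 f2 : loop g := Loop (loop_lie_subproof f1 f2).

Definition affine_cocycle f1 f2 : F :=
  \sum_(i \in [set: int]) i%:~R * killing (f1 i) (f2 (- i)).

Definition affine : Type := (loop g * F^o)%type.
HB.instance Definition _ := GRing.Lmodule.copy affine (loop g * F^o)%type.

(* The first component is the loop algebra, the second one the coefficient of
   the central element [K]. *)
Definition affine_lie (X Y : affine) : affine :=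
  (loop_lie X.1 Y.1, affine_cocycle X.1 Y.1).

Definition affineK : affine := (0, 1).

Definition affine_mono x m : affine := (mono x m, 0).

Lemma affineP (X Y : affine) : X.1 = Y.1 -> X.2 = Y.2 -> X = Y.
Proof. by case: X Y => [? ?] [? ?] /= -> ->. Qed.

Lemma loop_lieE f1 f2 n :
  loop_lie f1 f2 n = \sum_(i \in [set: int]) [lie f1 i, f2 (n - i)].
Proof. by []. Qed.

Lemma affine_lie_linearl Z : linear (fun X => affine_lie X Z).
Proof.
move=> a X Y.
have fin := loop_fin X.1; have finY := loop_fin Y.1.
pose A := [set n | X.1 n != 0] `|` [set n | Y.1 n != 0].
have finA : finite_set A by rewrite finite_setU.
have X0 i : ~ A i -> X.1 i = 0.
  by move=> nA; apply/eqP/negPn/negP => Xi; apply: nA; left.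
have Y0 i : ~ A i -> Y.1 i = 0.
  by move=> nA; apply/eqP/negPn/negP => Yi; apply: nA; right.
apply: affineP => /=.
  apply: loopP => n; rewrite loop_linE !loop_lieE -(fsum_linear _ finA).
  - by apply: eq_fsbigr => i _; exact: lie_linearl.
  - by move=> i /X0 ->; rewrite lie0l.
  - by move=> i /Y0 ->; rewrite lie0l.
rewrite /affine_cocycle -(fsum_linear (W := F^o) _ finA).
- apply: eq_fsbigr => i _; rewrite loop_linE killing_linearl mulrDr.
  by rewrite mulrCA.
- by move=> i /X0 ->; rewrite killing0l mulr0.
- by move=> i /Y0 ->; rewrite killing0l mulr0.
Qed.

Lemma affine_lie_linearr Z : linear (affine_lie Z).
Proof.
move=> a X Y.
pose A := [set n | Z.1 n != 0].
have finA : finite_set A := loop_fin Z.1.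
have Z0 i : ~ A i -> Z.1 i = 0.
  by move=> nA; apply/eqP/negPn/negP => Xi; apply: nA.
apply: affineP => /=.
  apply: loopP => n; rewrite loop_linE !loop_lieE -(fsum_linear _ finA).
  - by apply: eq_fsbigr => i _; exact: lie_linearr.
  - by move=> i /Z0 ->; rewrite lie0l.
  - by move=> i /Z0 ->; rewrite lie0l.
rewrite /affine_cocycle -(fsum_linear (W := F^o) _ finA).
- apply: eq_fsbigr => i _; rewrite loop_linE killing_linearr mulrDr.
  by rewrite mulrCA.
- by move=> i /Z0 ->; rewrite killing0l mulr0.
- by move=> i /Z0 ->; rewrite killing0l mulr0.
Qed.

Lemma affine_mono_linear m : linear (affine_mono^~ m).
Proof.
move=> a x y; apply: affineP; first by rewrite /= mono_linear.
by rewrite /= scaler0 addr0.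
Qed.

Lemma affine_monoD x y m :
  affine_mono (x + y) m = affine_mono x m + affine_mono y m.
Proof. by rewrite -[x in LHS]scale1r affine_mono_linear scale1r. Qed.

Lemma affine_monoN x m : affine_mono (- x) m = - affine_mono x m.
Proof.
apply/eqP; rewrite -addr_eq0 -affine_monoD addNr.
by rewrite (linear_fun0 (affine_mono_linear m)).
Qed.

Lemma affine_lie_mono x m y n :
  affine_lie (affine_mono x m) (affine_mono y n) =
  affine_mono [lie x, y] (m + n) +
  (m%:~R * (m + n == 0)%:R * killing x y) *: affineK.
Proof.
have out (W : zmodType) (G : int -> W) : (forall i, i != m -> G i = 0) ->
    \sum_(i \in [set: int]) G i = G m.
  move=> G0; transitivity (\sum_(i \in [set m]) G i); last exact: fsbig_set1.
  by apply/esym/fsbig_widen => // i [_] /= /eqP; exact: G0.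
apply: affineP => /=.
  apply: loopP => k; rewrite scaler0 addr0 loop_lieE monoE out => [|i im].
    rewrite !monoE eqxx subr_eq (addrC n m).
    by case: ifP; rewrite // linear0.
  by rewrite monoE (negPf im) lie0l.
rewrite add0r /affine_cocycle out => [|i im]; last first.
  by rewrite monoE (negPf im) killing0l mulr0.
rewrite !monoE eqxx -[_ *: _]/(_ * 1) mulr1 -mulrA; congr (_ * _).
rewrite eq_sym -addr_eq0 addrC; case: eqP; rewrite ?mul1r //.
by rewrite mul0r killingC killing0l.
Qed.

Lemma affine_lieK X : affine_lie X affineK = 0.
Proof.
apply: affineP => /=.
  by apply: loopP => k; rewrite loop_lieE fsbig1 // => i _; rewrite linear0.
by apply: fsbig1 => i _; rewrite killingC killing0l mulr0.
Qed.

Lemma affine_Klie X : affine_lie affineK X = 0.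
Proof.
apply: affineP => /=.
  by apply: loopP => k; rewrite loop_lieE fsbig1 // => i _; rewrite lie0l.
by apply: fsbig1 => i _; rewrite killing0l mulr0.
Qed.

Lemma affine_ind (P : affine -> Prop) :
    (forall a X Y, P X -> P Y -> P (a *: X + Y)) ->
    P 0 -> (forall x m, P (affine_mono x m)) -> P affineK -> forall X, P X.
Proof.
move=> Plin P0 Pmono PK [f c].
have -> : (f, c) = c *: affineK + \sum_(m <- fset_set [set n | f n != 0])
    affine_mono (f m) m :> affine.
  have E (r : seq int) : \sum_(m <- r) affine_mono (f m) m =
      (\sum_(m <- r) mono (f m) m, 0) :> affine.
    elim: r => [|i r IH]; first by rewrite !big_nil.
    by rewrite !big_cons IH; apply: affineP; rewrite //= addr0.
  rewrite E -loop_mono_sum; apply: affineP => /=.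
    by rewrite scaler0 add0r.
  by rewrite addr0 -[_ *: _]/(_ * 1) mulr1.
apply: (Plin) => //; apply: big_ind => // X Y PX PY.
by rewrite -[X]scale1r; exact: Plin.
Qed.

Lemma affine_lie_anti X Y : affine_lie X Y = - affine_lie Y X.
Proof.
elim/affine_ind: X => [a X X' IH IH'||x m|].
- by rewrite affine_lie_linearl affine_lie_linearr IH IH' scalerN opprD.
- by rewrite (linear_fun0 (affine_lie_linearl Y))
             (linear_fun0 (@affine_lie_linearr Y)) oppr0.
- elim/affine_ind: Y => [a Y Y' IH IH'||y n|].
  + by rewrite affine_lie_linearl affine_lie_linearr IH IH' scalerN opprD.
  + by rewrite (linear_fun0 (affine_lie_linearl _))
               (linear_fun0 (@affine_lie_linearr _)) oppr0.
  + rewrite !affine_lie_mono opprD -scaleNr (addrC n m) (killingC y).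
    congr (_ + _ *: _); first by rewrite lie_anti affine_monoN.
    case: eqP => [/eqP|_]; last by rewrite !mulr0 !mul0r oppr0.
    by rewrite addr_eq0 => /eqP ->; rewrite rmorphN !mulr1 /= mulNr.
  + by rewrite affine_lieK affine_Klie oppr0.
- by rewrite affine_lieK affine_Klie oppr0.
Qed.

Lemma affine_liexx X : affine_lie X X = 0.
Proof.
elim/affine_ind: X => [a X Y IHX IHY||x m|].
- rewrite affine_lie_linearl !affine_lie_linearr IHX IHY (affine_lie_anti Y X).
  by rewrite scaler0 add0r addr0 scalerN addrN.
- exact: linear_fun0 (affine_lie_linearl _).
- rewrite affine_lie_mono liexx (linear_fun0 (affine_mono_linear _)) add0r.
  have [m0|_] := eqVneq (m + m) 0; last by rewrite mulr0 mul0r scale0r.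
  have -> : m = 0 by lia.
  by rewrite !mul0r scale0r.
- exact: affine_lieK.
Qed.

Lemma affine_jacobi X Y Z :
  affine_lie X (affine_lie Y Z) + affine_lie Y (affine_lie Z X) +
  affine_lie Z (affine_lie X Y) = 0.
Proof.
pose J X Y Z := affine_lie X (affine_lie Y Z) + affine_lie Y (affine_lie Z X) +
  affine_lie Z (affine_lie X Y).
rewrite -/(J X Y Z).
have rot A B C : J A B C = J B C A by rewrite /J -addrA addrC.
have sum3 (a : F) (u u' v v' w w' : affine) :
    (a *: u + u') + (a *: v + v') + (a *: w + w') = a *: (u + v + w) + (u' + v' + w').
  by rewrite !scalerDr (addrACA (a *: u)) (addrACA (a *: u + _)).
have Jlin B C : linear (fun A => J A B C).
  move=> a A A'; rewrite /J.
  have -> := affine_lie_linearl (affine_lie B C) a A A'.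
  have -> := affine_lie_linearr C a A A'.
  have -> := affine_lie_linearr B a (affine_lie C A) (affine_lie C A').
  have -> := affine_lie_linearl B a A A'.
  have -> := affine_lie_linearr C a (affine_lie A B) (affine_lie A' B).
  exact: sum3.
have JK B C : J (affineK) B C = 0.
  by rewrite /J affine_Klie affine_lieK affine_Klie
    !(linear_fun0 (@affine_lie_linearr _)) !addr0.
elim/affine_ind: X => [a X X' IH IH'||x m|]; last exact: JK.
- by rewrite Jlin IH IH' scaler0 addr0.
- exact: linear_fun0 (Jlin Y Z).
rewrite rot; elim/affine_ind: Y => [a X X' IH IH'||y n|]; last exact: JK.
- by rewrite Jlin IH IH' scaler0 addr0.
- exact: linear_fun0 (Jlin _ _).
rewrite rot; elim/affine_ind: Z => [a X X' IH IH'||z p|]; last exact: JK.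
- by rewrite Jlin IH IH' scaler0 addr0.
- exact: linear_fun0 (Jlin _ _).
have mm u i v j w k : affine_lie (affine_mono u i)
    (affine_lie (affine_mono v j) (affine_mono w k)) =
    affine_mono [lie u, [lie v, w]] (i + j + k) +
    (i%:~R * (i + j + k == 0)%:R * killing u [lie v, w]) *: affineK.
  rewrite [X in affine_lie _ X]affine_lie_mono addrC affine_lie_linearr.
  by rewrite affine_lieK scaler0 add0r affine_lie_mono addrA.
rewrite /J !mm.
have -> : m + n + p = p + m + n by lia.
have -> : n + p + m = p + m + n by lia.
rewrite -killing_lie (killingC [lie z, x] y) (killingC x) killing_lie.
set k := killing _ _.
have sum3' (u u' v v' w w' : affine) :
    (u + u') + (v + v') + (w + w') = (u + v + w) + (u' + v' + w').
  by have := sum3 1 u u' v v' w w'; rewrite !scale1r.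
rewrite sum3' -!scalerDl -!affine_monoD addrC.
have -> : [lie z, [lie x, y]] + [lie x, [lie y, z]] + [lie y, [lie z, x]] = 0.
  by rewrite -addrA addrC lie_jacobi.
rewrite (linear_fun0 (affine_mono_linear _)) addr0 -!mulrDl -!rmorphD /=.
by case: eqP => [->|_]; rewrite ?mulr0 !mul0r scale0r.
Qed.

HB.instance Definition _ := isLieAlgebra.Build F affine
  affine_lie_linearl affine_lie_linearr affine_liexx affine_jacobi.

End Affine.

Section TensorProduct.
Variable F : fieldType.

Definition multilinear (m : nat) (V : 'I_m -> lmodType F) (T : lmodType F)
    (tau : (forall i, V i) -> T) : Prop :=
  forall (v : forall i, V i) (i : 'I_m), linear (fun x : V i => tau (dfwith v x)).

Definition is_tensor_product (m : nat) (V : 'I_m -> lmodType F)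
    (T : lmodType F) (tau : (forall i, V i) -> T) : Prop :=
  multilinear tau /\
  forall (U : lmodType F) (b : (forall i, V i) -> U), multilinear b ->
    exists u : {linear T -> U}, (forall v, u (tau v) = b v) /\
      forall u' : {linear T -> U}, (forall v, u' (tau v) = b v) -> u' =1 u.

Definition bilinear2 (V W T : lmodType F) (tau : V -> W -> T) : Prop :=
  (forall w, linear (fun v => tau v w)) /\ (forall v, linear (tau v)).

Definition is_tensor_product2 (V W T : lmodType F) (tau : V -> W -> T) : Prop :=
  bilinear2 tau /\
  forall (U : lmodType F) (b : V -> W -> U), bilinear2 b ->
    exists u : {linear T -> U}, (forall v w, u (tau v w) = b v w) /\
      forall u' : {linear T -> U}, (forall v w, u' (tau v w) = b v w) -> u' =1 u.

(* The image of [V (x) N] in [T = V (x) W]; the map is injective over a field. *)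
Definition tensor_sub (V W T : lmodType F) (tau : V -> W -> T) (N : set W) :
    set T :=
  lspan [set t | exists v w, N w /\ t = tau v w].

(* [T] is the tensor product of the modules [V] and [W] via [tau]. *)
Definition is_tensor_module (g : lieAlgType F) (V W T : lieModType g)
    (tau : V -> W -> T) : Prop :=
  is_tensor_product2 tau /\
  forall (x : g) v w,
    lieact x (tau v w) = tau (lieact x v) w + tau v (lieact x w).

End TensorProduct.

Section AffineModules.
Variables (F : fieldType) (g : finLieAlgType F).

(* [E] is the tensor product of the [V i] via [tau], on which [x (x) t^k] acts
   by evaluation at the points [a i] and [K] acts as 0. These conditions
   determine the action of the whole affine algebra on [E]. *)
Definition is_evaluation_module (m : nat) (V : 'I_m -> lieModType g)
    (a : 'I_m -> F) (E : lieModType (affine g)) (tau : (forall i, V i) -> E) :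
    Prop :=
  [/\ is_tensor_product tau,
      (forall e : E, lieact (affineK g) e = 0)
    & forall (x : g) (k : int) (v : forall i, V i),
        lieact (affine_mono x k) (tau v) =
        \sum_(i < m) a i ^ k *: tau (dfwith v (lieact x (v i)))].

(* [f] ranges over the tensor product of [g] with t^k F[t]. *)
Definition smooth_module (L : lieModType (affine g)) : Prop :=
  forall v : L, exists k0 : nat, forall k : nat, (k0 <= k)%N ->
    forall f : loop g, (forall n : int, n < k%:Z -> f n = 0) ->
      lieact ((f, 0) : affine g) v = 0.

End AffineModules.

(* Main.v *)
(* Fix finitely many vectors of [L]. For large [k], [x (x) t^k] kills them, so on
   tensors over them it acts on [E] only; as the [a i] are distinct and nonzero, linear
   combinations of these operators make [x] act on a single factor [V i], and a
   submodule [M] is stable under all of these. Each [V i] is irreducible of countable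
   dimension over an uncountable algebraically closed field, hence has scalar
   endomorphisms, and Jacobson density allows one to isolate the coefficients of an
   element of [M], one factor at a time. The coefficients lie in
   [N = {l | E (x) l <= M}]. *)

From HB Require Import structures.
Require Import Defs.
From mathcomp Require Import finmap cardinality.
From mathcomp Require Import all_boot all_order all_algebra.
From mathcomp Require Import boolp classical_sets reals complex.
From mathcomp Require lebesgue_measure.

Set Implicit Arguments.
Unset Strict Implicit.
Unset Printing Implicit Defensive.

Import Order.TTheory GRing.Theory Num.Theory.

Local Open Scope classical_set_scope.
Local Open Scope ring_scope.

(** * Uncountability of the complex numbers *)

(** A countable set has Lebesgue measure 0, but the real unit interval, which embeds in [R[i]], has
    measure 1. *)
Lemma complex_uncountable (R : realType) : ~ countable [set: R[i]].
Proof.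
move=> /countable_injP[f f_inj].
have c01 : countable [set` `[(0 : R), 1]].
  apply/countable_injP; exists (fun x : R => f x%:C%C) => x y _ _ fxy.
  by apply: (@complexI R); apply: f_inj => //; exact: mem_set.
have := lebesgue_measure.lebesgue_measure_itv `[(0 : R), 1].
rewrite lebesgue_measure.countable_lebesgue_measure0 //= constructive_ereal.lte_fin ltr01.
rewrite constructive_ereal.sube0 => -[/esym/eqP].
by rewrite oner_eq0.
Qed.

(** * Linear maps and finite spans *)

Section LinearFun.
Variables (F : fieldType) (U W : lmodType F) (f : U -> W).
Hypothesis f_lin : linear f.

Lemma linear_funZ a x : f (a *: x) = a *: f x.
Proof. by have := f_lin a x 0; rewrite (linear_fun0 f_lin) !addr0. Qed.

Lemma linear_funD x y : f (x + y) = f x + f y.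
Proof. by have := f_lin 1 x y; rewrite !scale1r. Qed.

Lemma linear_fun_sum I (r : seq I) (P : pred I) (u : I -> U) :
  f (\sum_(i <- r | P i) u i) = \sum_(i <- r | P i) f (u i).
Proof. exact: (big_morph f linear_funD (linear_fun0 f_lin)). Qed.

End LinearFun.

Section Span.
Variables (F : fieldType) (V : lmodType F).

Lemma subspaceZ (S : set V) a x : is_subspace S -> S x -> S (a *: x).
Proof. by case=> S0 S_lin Sx; rewrite -[_ *: _]addr0; exact: S_lin. Qed.

Lemma subspaceD (S : set V) x y : is_subspace S -> S x -> S y -> S (x + y).
Proof. by case=> S0 S_lin Sx Sy; rewrite -[x]scale1r; exact: S_lin. Qed.

Lemma subspace_sum (S : set V) I (r : seq I) (P : pred I) (f : I -> V) :
  is_subspace S -> (forall i, P i -> S (f i)) -> S (\sum_(i <- r | P i) f i).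
Proof.
move=> S_sub Sf; apply: big_ind => //; first by case: S_sub.
by move=> x y; exact: subspaceD.
Qed.

(** [V] may be infinite-dimensional, so spans are plain sets; coefficients indexed by [nat] avoid
    casts between ordinals. *)
Definition span_first (w : nat -> V) (N : nat) : set V :=
  [set v | exists c : nat -> F, v = \sum_(n < N) c n *: w n].

Lemma span_first_subspace w N : is_subspace (span_first w N).
Proof.
split=> [|a _ _ [c ->] [d ->]].
  by exists (fun=> 0); rewrite big1 // => n _; rewrite scale0r.
exists (fun n => a * c n + d n); rewrite scaler_sumr -big_split /=.
by apply: eq_bigr => n _; rewrite scalerDl scalerA.
Qed.

Lemma span_first_mem w N n : (n < N)%N -> span_first w N (w n).
Proof.
move=> nN; exists (fun k => (k == n)%:R).
rewrite (bigD1 (Ordinal nN)) //= eqxx scale1r big1 ?addr0 // => k.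
by rewrite -val_eqE /= => /negPf ->; rewrite scale0r.
Qed.

Lemma span_first_le w N N' : (N <= N')%N -> span_first w N `<=` span_first w N'.
Proof.
move=> NN' _ [c ->]; apply: subspace_sum (span_first_subspace w N') _ => n _.
apply: subspaceZ (span_first_subspace w N') _; apply: span_first_mem.
exact: leq_trans NN'.
Qed.

(** The coordinates form a matrix with one more row than columns; a nonzero vector of its left
    kernel is the relation. *)
Lemma span_first_dependent w N (z : 'I_N.+1 -> V) :
    (forall j, span_first w N (z j)) ->
  exists2 al : 'I_N.+1 -> F, (exists j, al j != 0) & \sum_j al j *: z j = 0.
Proof.
move=> /choice[c zE].
pose A : 'M[F]_(N.+1, N) := \matrix_(j, n) c j n.
have kerA0 : kermx A != 0.
  by rewrite kermx_eq0 /row_free ltn_eqF // ltnS rank_leq_col.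
pose u := nz_row (kermx A).
have uA : u *m A = 0 by apply/sub_kermxP; exact: nz_row_sub.
exists (u 0) => [|].
  apply: contrapT => u0; case/negP: kerA0; rewrite -nz_row_eq0; apply/eqP/rowP => j.
  rewrite [RHS]mxE; apply: contrapT => /eqP uj; apply: u0; by exists j.
under eq_bigr do rewrite zE scaler_sumr.
rewrite exchange_big big1 // => n _.
under eq_bigr do rewrite scalerA.
rewrite -scaler_suml; have /rowP/(_ n) := uA; rewrite !mxE => uAn.
rewrite (_ : \sum_j _ = 0) ?scale0r // -[RHS]uAn; apply: eq_bigr => j _.
by rewrite mxE.
Qed.

End Span.

(** * Polynomials in an endomorphism *)

Section PolynomialAction.
Variables (F : fieldType) (V : lmodType F) (phi : {linear V -> V}).
Implicit Types (p q : {poly F}) (v : V).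

(** This is [p(phi)] applied to [v]. *)
Definition pact p v : V := \sum_(k < size p) p`_k *: iter k phi v.

Lemma pactE p v N : (size p <= N)%N ->
  pact p v = \sum_(k < N) p`_k *: iter k phi v.
Proof.
move=> pN; rewrite /pact (big_ord_widen N (fun k => p`_k *: iter k phi v)) //.
rewrite big_mkcond; apply: eq_bigr => k _; case: ltnP => // pk.
by rewrite nth_default ?scale0r.
Qed.

Lemma pact_linearl v : linear (pact^~ v).
Proof.
move=> a p q; pose N := maxn (size (a *: p + q)) (maxn (size p) (size q)).
rewrite !(@pactE _ _ N) ?leq_max ?leqnn ?orbT //.
rewrite scaler_sumr -big_split; apply: eq_bigr => k _.
by rewrite coefD coefZ scalerDl scalerA.
Qed.

Lemma iter_linear k : linear (iter k phi).
Proof. by elim: k => [|k IH] a v w //=; rewrite IH linearP. Qed.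

Lemma pact_linearr p : linear (pact p).
Proof.
move=> a v w; rewrite scaler_sumr -big_split; apply: eq_bigr => k _ /=.
by rewrite iter_linear scalerDr !scalerA mulrC.
Qed.

Lemma pact_phi p v : pact p (phi v) = phi (pact p v).
Proof.
by rewrite linear_sum; apply: eq_bigr => k _; rewrite -iterSr linearZ.
Qed.

Lemma pact1 v : pact 1 v = v.
Proof. by rewrite (@pactE _ _ 1) ?size_poly1 // big_ord1 coef1 scale1r. Qed.

Lemma pactXM p v : pact ('X * p) v = phi (pact p v).
Proof.
rewrite (@pactE _ _ (size p).+1); last first.
  have [->|p0] := eqVneq p 0; first by rewrite mulr0 size_poly0.
  by rewrite mulrC size_mulX.
rewrite big_ord_recl coefXM eqxx scale0r add0r linear_sum.
by apply: eq_bigr => k _; rewrite coefXM linearZ.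
Qed.

Lemma pactXsubC c p v : pact (('X - c%:P) * p) v = phi (pact p v) - c *: pact p v.
Proof.
rewrite mulrBl mul_polyC addrC -scaleNr pact_linearl pactXM.
by rewrite scaleNr addrC.
Qed.

Lemma pactXsubC_r c p v : pact (('X - c%:P) * p) v = pact p (phi v - c *: v).
Proof.
by rewrite pactXsubC addrC -scaleNr [in RHS]addrC -scaleNr pact_linearr pact_phi.
Qed.

End PolynomialAction.

(** Over an algebraically closed field [p] splits into linear factors, and each [phi - c] is
    injective. *)
Lemma pact_inj (F : closedFieldType) (V : lmodType F) (phi : {linear V -> V})
    (p : {poly F}) (v : V) :
    (forall c u, phi u - c *: u = 0 -> u = 0) -> p != 0 -> pact phi p v = 0 ->
  v = 0.
Proof.
move=> phi_inj; have [r ->] := closed_field_poly_normal p.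
rewrite scaler_eq0 negb_or lead_coef_eq0 => /andP[p0 _].
rewrite (linear_funZ (pact_linearl phi v)) => /eqP.
rewrite scaler_eq0 lead_coef_eq0 (negPf p0) /= => /eqP.
elim: r => [|c r IH]; first by rewrite big_nil pact1.
by rewrite big_cons pactXsubC => /phi_inj.
Qed.

(** * Irreducible modules: countable dimension, Schur's lemma, density *)

Section Irreducible.
Variables (F : closedFieldType) (g : finLieAlgType F) (V : lieModType g).

HB.instance Definition _ (x : g) :=
  GRing.isLinear.Build F V V _ (lieact x) (lieact_linearr x).

Hypothesis V_irr : irreducible_module V.

Lemma irreducible_full (S : set V) :
  is_submodule S -> (exists2 v, S v & v != 0) -> S = [set: V].
Proof.
case: V_irr => _ irr S_sub [v Sv v0]; case: (irr S S_sub) => // SE.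
by move: Sv; rewrite SE => /eqP; rewrite (negPf v0).
Qed.

(** Words in a finite basis of [g], applied to a nonzero vector, are countably many and span a
    nonzero submodule. *)
Lemma irreducible_countable_span :
  exists w : nat -> V, forall v, exists N, span_first w N v.
Proof.
have [[v0 v0n0] _] := V_irr; pose b := vbasis {:g}.
pose word (s : seq nat) := foldr (fun i v => lieact b`_i v) v0 s.
(* Numbers that encode no word contribute the zero vector. *)
pose w n := if unpickle n is Some s then word s else 0.
pose S := [set v | exists N, span_first w N v].
have Sw s : S (word s).
  exists (pickle s).+1; have -> : word s = w (pickle s) by rewrite /w pickleK.
  exact: span_first_mem.
have S_sub : is_subspace S.
  split=> [|a x y [M xM] [N yN]].
    by exists 0%N; case: (span_first_subspace w 0).
  exists (maxn M N); have [_] := span_first_subspace w (maxn M N); apply.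
    by apply: span_first_le xM; exact: leq_maxl.
  by apply: span_first_le yN; exact: leq_maxr.
exists w => v; suff SE : S = [set: V] by have : S v by rewrite SE.
apply: irreducible_full; last by exists v0 => //; exact: (Sw [::]).
split=> // x _ [N [c ->]].
rewrite linear_sum; apply: (@subspace_sum _ _ S) => // n _.
rewrite linearZ /=; apply: (@subspaceZ _ _ S) => //.
rewrite [x](coord_vbasis (memvf x)) (linear_fun_sum (lieact_linearl (w n))).
apply: (@subspace_sum _ _ S) => // i _.
rewrite (linear_funZ (lieact_linearl (w n))).
apply: (@subspaceZ _ _ S) => //=; rewrite /w.
case: unpickle => [s|]; first exact: (Sw (nat_of_ord i :: s)).
by rewrite linear0; case: S_sub.
Qed.

(* Dixmier's form of Schur's lemma: otherwise every [phi - c] is invertible, and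
   by partial fractions the vectors [(phi - c)^-1 v0], with [c] in [F], are
   linearly independent, whereas [V] has countable dimension. *)
Lemma irreducible_schur (phi : {linear V -> V}) :
    ~ countable [set: F] ->
    (forall x v, phi (lieact x v) = lieact x (phi v)) ->
  exists c, forall v, phi v = c *: v.
Proof.
move=> F_unc phiC; apply: contrapT => phi_nscalar.
have [[v0 v0n0] _] := V_irr.
have psiD c a u v : phi (a *: u + v) - c *: (a *: u + v) =
    a *: (phi u - c *: u) + (phi v - c *: v).
  rewrite linearP scalerDr opprD scalerA mulrC -scalerA.
  by rewrite scalerBr addrACA.
have psi0 c : phi 0 - c *: 0 = 0 by rewrite linear0 scaler0 subr0.
have psiC c x v : phi (lieact x v) - c *: lieact x v = lieact x (phi v - c *: v).
  by rewrite phiC linearB /= [lieact x (c *: v)]linearZ.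
have psi_n0 c : exists v, phi v - c *: v != 0.
  apply: contrapT => no; apply: phi_nscalar; exists c => v.
  apply/eqP; rewrite -subr_eq0; apply: contrapT => /negP nv; apply: no.
  by exists v.
have psi_inj c v : phi v - c *: v = 0 -> v = 0.
  move=> psiv; apply: contrapT => /eqP vn0.
  pose S := [set u | phi u - c *: u = 0].
  have SE : S = [set: V].
    apply: irreducible_full; last by exists v.
    split=> [|x u Su]; last by rewrite /S /= psiC Su linear0.
    split=> [|a u u' Su Su'] /=; first exact: psi0.
    by have := psiD c a u u'; rewrite Su Su' scaler0 addr0.
  have [u /eqP[]] := psi_n0 c.
  by have : S u by rewrite SE.
have psi_surj c : exists v, phi v - c *: v = v0.
  pose S := [set u | exists v, phi v - c *: v = u].
  suff SE : S = [set: V] by have : S v0 by rewrite SE.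
  apply: irreducible_full; last first.
    by have [u un0] := psi_n0 c; exists (phi u - c *: u) => //; exists u.
  split=> [|x _ [v <-]]; last by exists (lieact x v).
  split=> [|a _ _ [v <-] [v' <-]].
    by exists 0; exact: psi0.
  by exists (a *: v + v'); exact: psiD.
(* [r c] plays the role of [(phi - c)^-1 v0]. *)
have [r rE] := choice psi_surj.
have [w w_span] := irreducible_countable_span.
have [nn nnE] := choice (fun c => w_span (r c)).
(* Countably many finite fibres of [nn] could not cover the uncountable field. *)
have [N A_inf] : exists N, infinite_set [set c | nn c = N].
  apply: contrapT => all_fin; apply: F_unc.
  have -> : [set: F] = \bigcup_N [set c | nn c = N].
    by apply/esym; rewrite -subTset => c _; exists (nn c).
  apply: bigcup_countable => // N _; apply: finite_set_countable.
  by apply: contrapT => A_inf; apply: all_fin; exists N.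
(* [N.+1] parameters from this fibre give vectors [r c] in the span of [N] vectors, hence a linear
   relation. *)
have [B BA B_ge] := infinite_set_fset N.+1 A_inf.
pose z (j : 'I_N.+1) := (enum_fset B)`_j.
have z_inj : injective z.
  move=> j k /eqP; rewrite nth_uniq ?fset_uniq //; first by move/eqP/val_inj.
    exact: leq_trans (ltn_ord j) B_ge.
  exact: leq_trans (ltn_ord k) B_ge.
have zN j : nn (z j) = N.
  by apply: BA => /=; apply: mem_nth; exact: leq_trans (ltn_ord j) B_ge.
have [|al [j alj] al_dep] := @span_first_dependent F V w N (r \o z).
  by move=> j /=; rewrite -{1}(zN j).
(* Clearing denominators in the relation among the [(phi - z k)^-1 v0] gives the polynomial [p],
   which kills [v0]. *)
pose q k : {poly F} := \prod_(i | i != k) ('X - (z i)%:P).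
pose p := \sum_k al k *: q k.
have p_v0 : pact phi p v0 = 0.
  pose P := \prod_i ('X - (z i)%:P).
  rewrite -[RHS](linear_fun0 (pact_linearr phi P)) -al_dep.
  rewrite (linear_fun_sum (pact_linearl phi v0)).
  rewrite (linear_fun_sum (pact_linearr phi P)); apply: eq_bigr => k _.
  rewrite (linear_funZ (pact_linearl phi v0)) (linear_funZ (pact_linearr phi P)).
  congr (_ *: _); rewrite /P.
  by rewrite (bigD1 k) //= pactXsubC_r rE.
have p_n0 : p != 0.
  (* At [z j] every [q k] with [k != j] vanishes, so [p] takes the value [al j] times a nonzero
     product. *)
  apply: contraNneq alj => p0; have := congr1 (fun f : {poly F} => f.[z j]) p0.
  rewrite horner0 horner_sum (bigD1 j) //= big1 => [|k kj].
    rewrite addr0 hornerZ horner_prod => /eqP; rewrite mulf_eq0 => /orP[//|].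
    move/prodf_eq0 => [i ij]; rewrite hornerXsubC subr_eq0 => /eqP/z_inj ji.
    by rewrite ji eqxx in ij.
  rewrite hornerZ horner_prod (bigD1 j) 1?eq_sym //= hornerXsubC subrr.
  by rewrite mul0r mulr0.
by have := pact_inj psi_inj p_n0 p_v0; apply/eqP.
Qed.

(** The image of the universal enveloping algebra in [End V]; left multiplication by elements of [g]
    reaches all words. *)
Inductive enveloping : (V -> V) -> Prop :=
| enveloping_id : enveloping id
| enveloping_lin a b c :
    enveloping b -> enveloping c -> enveloping (fun v => a *: b v + c v)
| enveloping_act x b : enveloping b -> enveloping (fun v => lieact x (b v)).

Lemma enveloping_linear b : enveloping b -> linear b.
Proof.
elim=> // [a b1 b2 _ lin1 _ lin2 | x b1 _ lin1] k u v.
  by rewrite lin1 lin2 !scalerDr addrACA !scalerA [a * k]mulrC.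
by rewrite lin1 linearP.
Qed.

Lemma enveloping0 : enveloping (fun=> 0).
Proof.
have := enveloping_lin (-1) enveloping_id enveloping_id.
by congr enveloping; apply/funext => v; rewrite scaleN1r addNr.
Qed.

Lemma enveloping_sub b c :
  enveloping b -> enveloping c -> enveloping (fun v => b v - c v).
Proof.
move=> benv cenv; have := enveloping_lin (-1) cenv benv.
by congr enveloping; apply/funext => v; rewrite scaleN1r addrC.
Qed.

Lemma enveloping_sum I (r : seq I) (b : I -> V -> V) :
  (forall i, enveloping (b i)) -> enveloping (fun v => \sum_(i <- r) b i v).
Proof.
move=> benv; elim: r => [|i r IH].
  by have := enveloping0; congr enveloping; apply/funext => v; rewrite big_nil.
have := enveloping_lin 1 (benv i) IH.
by congr enveloping; apply/funext => v; rewrite big_cons scale1r.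
Qed.

(** Equivalently, after summing over [k], enveloping operators can send the entries of [u] to any
    prescribed tuple of vectors. *)
Definition separated (u : seq V) : Prop :=
  forall k y, (k < size u)%N -> exists2 b, enveloping b &
    forall k', (k' < size u)%N -> b u`_k' = if k' == k then y else 0.

(* Jacobson's density argument: if the elements killing [u] also kill [v], then
   [u`_k |-> v] factors through endomorphisms of [V], which are scalars. *)
Lemma separated_rcons (u : seq V) (v : V) : ~ countable [set: F] ->
  separated u -> span_first (nth 0 u) (size u) v \/ separated (rcons u v).
Proof.
move=> F_unc u_sep.
pose kills b := enveloping b /\ forall k : 'I_(size u), b u`_k = 0.
(* The annihilator of [u] is a left ideal, so its values at [v] form a submodule, which is zero or
   everything. *)
pose S := [set z | exists2 b, kills b & b v = z].
have S_sub : is_submodule S.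
  split=> [|x _ [b [benv bu] <-]]; last first.
    exists (fun v => lieact x (b v)) => //; split=> [|k].
      exact: enveloping_act.
    by rewrite bu linear0.
  split=> [|a _ _ [b [benv bu] <-] [c [cenv cu] <-]].
    by exists (fun=> 0) => //; split=> //; exact: enveloping0.
  exists (fun v => a *: b v + c v) => //; split=> [|k].
    exact: enveloping_lin.
  by rewrite bu cu scaler0 addr0.
case: V_irr => _ /(_ S S_sub)[S0|ST]; [left | right].
  (* If [S] is zero, the value of an operator at [v] depends only on its values on [u]. *)
  have agree b c : enveloping b -> enveloping c ->
      (forall k : 'I_(size u), b u`_k = c u`_k) -> b v = c v.
    move=> benv cenv bc; apply/eqP; rewrite -subr_eq0; apply/eqP.
    suff: S (b v - c v) by rewrite S0.
    exists (fun v => b v - c v) => //; split=> [|k]; first exact: enveloping_sub.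
    by rewrite bc subrr.
  have [b0 b0P] : exists b0 : 'I_(size u) -> V -> V -> V, forall k y,
      enveloping (b0 k y) /\
      forall k' : 'I_(size u), b0 k y u`_k' = if k' == k then y else 0.
    have /choice[b0 b0P] : forall ky : 'I_(size u) * V, exists b,
        enveloping b /\
        forall k' : 'I_(size u), b u`_k' = if k' == ky.1 then ky.2 else 0.
      move=> [k y]; have [b benv bu] := u_sep k y (ltn_ord k).
      by exists b; split=> // k'; rewrite bu.
    by exists (fun k y => b0 (k, y)) => k y; exact: (b0P (k, y)).
  have b0env k y : enveloping (b0 k y) by case: (b0P k y).
  have b0E k y (k' : 'I_(size u)) : b0 k y u`_k' = if k' == k then y else 0.
    by case: (b0P k y).
  have b0_lin k : linear (fun y => b0 k y v).
    move=> a y z /=; rewrite (agree _ _ (b0env k (a *: y + z))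
      (enveloping_lin a (b0env k y) (b0env k z))) // => k'.
    by rewrite !b0E; case: eqP; rewrite // scaler0 addr0.
  (* By [agree], sending [y] to [b0 k y v] commutes with [g], so Schur's lemma applies. *)
  have b0_scalar k : exists c, forall y, b0 k y v = c *: y.
    pose phiP := GRing.isLinear.Build F V V _ (fun y => b0 k y v) (b0_lin k).
    pose phi : {linear V -> V} := HB.pack (fun y => b0 k y v) phiP.
    apply: (@irreducible_schur phi) => // x y /=.
    apply: (agree _ _ (b0env _ _) (enveloping_act x (b0env _ _))) => k'.
    by rewrite !b0E; case: eqP; rewrite ?linear0.
  have {b0_scalar}[c cE] := choice b0_scalar.
  have -> : v = \sum_(k < size u) c k *: u`_k.
    (* The identity and this sum agree on [u], hence at [v], which gives the coordinates of [v]. *)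
    rewrite (agree id (fun v => \sum_k b0 k u`_k v)) //.
    - by apply: eq_bigr => k _; rewrite cE.
    - exact: enveloping_id.
    - exact: enveloping_sum.
    move=> k; rewrite (bigD1 k) //= b0E eqxx big1 ?addr0 // => k' k'k.
    by rewrite b0E eq_sym (negPf k'k).
  apply: subspace_sum (span_first_subspace _ _) _ => k _.
  apply: subspaceZ (span_first_subspace _ _) _; exact: span_first_mem.
have Sall y : exists2 b, kills b & b v = y by suff: S y by []; rewrite ST.
move=> k y; rewrite size_rcons ltnS leq_eqVlt => /predU1P[->|ku].
  have [b [benv bu] bv] := Sall y; exists b => // k'.
  rewrite ltnS nth_rcons; case: ltngtP => // k'u _.
  exact: (bu (Ordinal k'u)).
(* Subtracting an operator that kills [u] and agrees with [b] at [v] makes the result vanish at [v]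
   too. *)
have [b benv bu] := u_sep k y ku.
have [c [cenv cu] cv] := Sall (b v).
exists (fun v => b v - c v) => [|k']; first exact: enveloping_sub.
rewrite ltnS nth_rcons; case: ltngtP => // [k'u|->] _.
  by rewrite (cu (Ordinal k'u)) bu // subr0.
by rewrite cv subrr gtn_eqF.
Qed.

(** A separated family is grown along [s]: each vector already lies in the span or can be appended.
    An operator separating [u k] then reads off the [k]-th coordinate. *)
Lemma enveloping_isolates (s : seq V) : ~ countable [set: F] ->
  exists (n : nat) (u : nat -> V) (c : V -> nat -> F),
    (forall v, v \in s -> v = \sum_(k < n) c v k *: u k) /\
    forall (k : 'I_n) y, exists2 b, enveloping b &
      forall v, v \in s -> b v = c v k *: y.
Proof.
move=> F_unc.
have [u u_sep us] : exists2 u, separated u &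
    forall v, v \in s -> span_first (nth 0 u) (size u) v.
  elim: s => [|v s [u u_sep us]]; first by exists [::].
  have [uv|uv_sep] := separated_rcons v F_unc u_sep.
    by exists u => // w; rewrite inE => /predU1P[->//|]; exact: us.
  exists (rcons u v) => // w; rewrite inE size_rcons => /predU1P[->|/us[c ->]].
    have := span_first_mem (nth 0 (rcons u v)) (ltnSn (size u)).
    by rewrite nth_rcons ltnn eqxx.
  apply: subspace_sum (span_first_subspace _ _) _ => k _.
  apply: subspaceZ (span_first_subspace _ _) _.
  have -> : u`_k = (rcons u v)`_k by rewrite nth_rcons ltn_ord.
  by apply: span_first_mem; rewrite ltnS ltnW.
have /choice[c cE] v : exists c : nat -> F,
    v \in s -> v = \sum_(k < size u) c k *: u`_k.
  by have [/us[c]|_] := boolP (v \in s); [exists c | exists (fun=> 0)].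
exists (size u), (nth 0 u), c; split=> // k y.
have [b benv bu] := u_sep k y (ltn_ord k); exists b => // v vs.
have bZ := linear_funZ (enveloping_linear benv).
rewrite {1}(cE v vs) (linear_fun_sum (enveloping_linear benv)).
rewrite (bigD1 k) //= bZ bu // eqxx big1 ?addr0 // => k' k'k.
by rewrite bZ bu // (inj_eq val_inj) (negPf k'k) scaler0.
Qed.

End Irreducible.

(** * Spanning by pure tensors, from the universal property *)

Section UniversalSpan.
Variables (F : fieldType) (T : lmodType F).

(** Carrying the proof in the predicate lets its closure instance be inferred, so that
    [subspace_type] becomes a module. *)
Definition subspace_pred (S : set T) of is_subspace S : {pred T} :=
  [pred x | `[<S x>]].

Variables (S : set T) (S_sub : is_subspace S).

Lemma subspace_pred_submod : submod_closed (subspace_pred S_sub).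
Proof.
case: S_sub => S0 S_lin; split=> [|a x y /asboolP Sx /asboolP Sy].
  exact/asboolP.
by apply/asboolP; exact: S_lin.
Qed.

HB.instance Definition _ :=
  GRing.isSubmodClosed.Build F T (subspace_pred S_sub) subspace_pred_submod.

Record subspace_type := SubspaceType {
  subspace_val :> T; _ : subspace_val \in subspace_pred S_sub }.

HB.instance Definition _ := [isSub for subspace_val].
HB.instance Definition _ := [Choice of subspace_type by <:].
HB.instance Definition _ := [SubChoice_isSubLmodule of subspace_type by <:].

(* A universal map corestricts to [S]; by uniqueness the corestriction followed
   by the inclusion is the identity. *)
Lemma universal_span (X : Type) (p : X -> T) :
    (exists u : {linear T -> subspace_type}, forall x, val (u (p x)) = p x) ->
    (exists u : {linear T -> T}, forall u' : {linear T -> T},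
       (forall x, u' (p x) = p x) -> u' =1 u) ->
  S = [set: T].
Proof.
move=> [u uE] [u0 u0E]; rewrite -subTset => t _.
have <- : val (u t) = t.
  have := u0E (val \o u : {linear T -> T}) uE t => /= ->.
  by rewrite -(u0E (idfun : {linear T -> T})).
by have /asboolP := valP (u t).
Qed.

End UniversalSpan.

Lemma tensor_product_span (F : fieldType) (m : nat) (V : 'I_m -> lmodType F)
    (T : lmodType F) (tau : (forall i, V i) -> T) (S : set T) :
    is_tensor_product tau -> is_subspace S -> (forall v, S (tau v)) ->
  S = [set: T].
Proof.
move=> [tau_lin univ] S_sub S_tau.
have inS v : tau v \in subspace_pred S_sub by exact/asboolP.
apply: (universal_span (S_sub := S_sub) (p := tau)).
  have [|u [uE _]] := univ (subspace_type S_sub) (fun v => SubspaceType (inS v)).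
    by move=> v i a x y; apply: val_inj; exact: tau_lin.
  by exists u => v; rewrite uE.
have [u [_ u_uniq]] := univ T tau tau_lin; by exists u.
Qed.

Lemma tensor_product2_span (F : fieldType) (V W T : lmodType F)
    (tau : V -> W -> T) (S : set T) :
    is_tensor_product2 tau -> is_subspace S -> (forall v w, S (tau v w)) ->
  S = [set: T].
Proof.
move=> [[tau_linl tau_linr] univ] S_sub S_tau.
have inS v w : tau v w \in subspace_pred S_sub by exact/asboolP.
apply: (universal_span (S_sub := S_sub) (p := fun vw : V * W => tau vw.1 vw.2)).
  have [|u [uE _]] :=
      univ (subspace_type S_sub) (fun v w => SubspaceType (inS v w)).
    split=> [w|v] a x y; apply: val_inj; [exact: tau_linl | exact: tau_linr].
  by exists u => -[v w]; rewrite uE.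
have [|u [_ u_uniq]] := univ T tau; first by split.
by exists u => u' u'E; apply: u_uniq => v w; exact: (u'E (v, w)).
Qed.

(** Take [t^k0] times the polynomial with roots [a j], [j != i0], normalised at [a i0]. The factor
    [t^k0] keeps all exponents large, and [a i0 != 0] keeps the normalising constant [d] nonzero. *)
Lemma evaluation_interpolation (F : fieldType) (m : nat) (a : 'I_m -> F)
    (i0 : 'I_m) (k0 : nat) : (forall i, a i != 0) -> injective a ->
  exists (N : nat) (c : nat -> F),
    forall i, \sum_(k < N) c k * a i ^+ (k0 + k) = (i == i0)%:R.
Proof.
move=> a0 a_inj; pose q : {poly F} := \prod_(j | j != i0) ('X - (a j)%:P).
pose d := q.[a i0] * a i0 ^+ k0; exists (size q), (fun k => q`_k / d) => i.
have -> : \sum_(k < size q) q`_k / d * a i ^+ (k0 + k) =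
    q.[a i] * a i ^+ k0 / d.
  rewrite horner_coef !mulr_suml; apply: eq_bigr => k _.
  by rewrite exprD mulrAC (mulrC (a i ^+ k0)) mulrA.
rewrite {}/d; have [->|i_i0] := eqVneq i i0.
  rewrite divff // mulf_neq0 ?expf_neq0 // horner_prod.
  apply/prodf_neq0 => j ji0.
  by rewrite hornerXsubC subr_eq0 (inj_eq a_inj) eq_sym.
by rewrite horner_prod (bigD1 i) //= hornerXsubC subrr !mul0r.
Qed.

(** * Submodules of the tensor product of an evaluation module and a smooth module *)

Section EvaluationTensor.
Variables (F : closedFieldType) (g : finLieAlgType F).
Hypothesis F_unc : ~ countable [set: F].
Variables (L : lieModType (affine g)) (m : nat) (a : 'I_m -> F).
Hypotheses (L_smooth : smooth_module L).
Hypotheses (a_neq0 : forall i, a i != 0) (a_inj : injective a).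
Variables (V : 'I_m -> lieModType g) (E : lieModType (affine g)).
Hypothesis V_irr : forall i, irreducible_module (V i).
Variable tauE : (forall i, V i) -> E.
Hypothesis E_eval : is_evaluation_module a tauE.
Variables (T : lieModType (affine g)) (tau : E -> L -> T).
Hypothesis T_tensor : is_tensor_module tau.
Variable M : set T.
Hypothesis M_sub : is_submodule M.

Let tauE_lin v i : linear (fun x : V i => tauE (dfwith v x)).
Proof. by have [[tauE_lin _] _ _] := E_eval; exact: tauE_lin. Qed.
Let tau_linl l : linear (tau^~ l).
Proof. by have [[[linl _] _] _] := T_tensor; exact: linl. Qed.
Let tau_linr e : linear (tau e).
Proof. by have [[[_ linr] _] _] := T_tensor; exact: linr. Qed.
Let M_subspace : is_subspace M. Proof. by case: M_sub. Qed.

Definition absorbed : set L := [set l | forall e, M (tau e l)].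

(** By the Leibniz rule, [e (x) X l] is [X (e (x) l) - X e (x) l], and both terms lie in [M]. *)
Lemma absorbed_submodule : is_submodule absorbed.
Proof.
split; first split.
- by move=> e; rewrite (linear_fun0 (tau_linr e)); case: M_subspace.
- move=> c x y Nx Ny e; rewrite tau_linr.
  by apply: subspaceD => //; exact: subspaceZ.
move=> X l Nl e; have [_ act_tau] := T_tensor.
have -> : tau e (lieact X l) = (-1) *: tau (lieact X e) l + lieact X (tau e l).
  by rewrite act_tau scaleN1r addKr.
apply: subspaceD => //; first exact: subspaceZ.
by case: M_sub => _; apply.
Qed.

Lemma absorbed_sub : tensor_sub tau absorbed `<=` M.
Proof. by move=> t; apply=> // _ [e [l [Nl ->]]]. Qed.

Lemma absorbed_subspace : is_subspace (tensor_sub tau absorbed).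
Proof.
split=> [W [W0 _] _ //|c x y Sx Sy W W_sub SW].
by case: (W_sub) => _; apply; [exact: Sx | exact: Sy].
Qed.

Lemma dfwith_id (i : 'I_m) (y : forall i, V i) : dfwith y (y i) = y.
Proof. by apply: functional_extensionality_dep => j; case: dfwithP. Qed.

Section Slots.
Variables (J : finType) (l : J -> L).

Lemma slot_act (v : J -> forall i, V i) (i : 'I_m) (x : g) :
    M (\sum_j tau (tauE (v j)) (l j)) ->
  M (\sum_j tau (tauE (dfwith (v j) (lieact x (v j i)))) (l j)).
Proof.
move=> Mv; have [_ act_tau] := T_tensor; have [_ _ act_tauE] := E_eval.
have [k_ k_kills] := choice (fun j => L_smooth (l j)).
(* As [J] is finite, one bound serves all [l j]. *)
pose k0 := (\max_j k_ j)%N.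
have kills k j : lieact (affine_mono x (k0 + k)%N) (l j) = 0.
  apply: (k_kills j (k0 + k)%N) => [|n nk].
    by apply: leq_trans (leq_addr _ _); exact: (leq_bigmax (F := k_)).
  by rewrite monoE lt_eqF.
have [N [c cE]] := evaluation_interpolation i k0 a_neq0 a_inj.
suff <- : \sum_(k < N) c k *: lieact (affine_mono x (k0 + k)%N)
      (\sum_j tau (tauE (v j)) (l j)) =
    \sum_j tau (tauE (dfwith (v j) (lieact x (v j i)))) (l j).
  apply: subspace_sum => // k _; apply: subspaceZ => //.
  by case: M_sub => _; apply.
under eq_bigr => k _.
  rewrite (linear_fun_sum (lieact_linearr _)) scaler_sumr.
  under eq_bigr => j _.
    rewrite act_tau kills (linear_fun0 (tau_linr _)) addr0 act_tauE.
    rewrite (linear_fun_sum (tau_linl _)) scaler_sumr.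
    under eq_bigr do rewrite (linear_funZ (tau_linl _)) scalerA.
    over.
  over.
(* Slot [i'] now carries the coefficient [\sum_k c k * a i' ^+ (k0 + k)], which is 1 for [i' = i]
   and 0 otherwise. *)
rewrite exchange_big; apply: eq_bigr => j _.
rewrite exchange_big (bigD1 i) //= -scaler_suml cE eqxx scale1r big1 ?addr0 //.
by move=> i' /negPf i'i; rewrite -scaler_suml cE i'i scale0r.
Qed.

Lemma slot_enveloping (v : J -> forall i, V i) (i : 'I_m) (b : V i -> V i) :
    enveloping b -> M (\sum_j tau (tauE (v j)) (l j)) ->
  M (\sum_j tau (tauE (dfwith (v j) (b (v j i)))) (l j)).
Proof.
move=> benv Mv; elim: benv => {b} [|c b1 b2 _ M1 _ M2|x b _ Mb].
- by under eq_bigr do rewrite dfwith_id.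
- under eq_bigr do rewrite tauE_lin tau_linl.
  rewrite big_split /= -scaler_sumr; apply: subspaceD => //.
  exact: subspaceZ.
- have := slot_act i x Mb; congr M; apply: eq_bigr => j _.
  congr (tau (tauE _) _); rewrite dfwith_in.
  apply: functional_extensionality_dep => i'.
  by case: (dfwithP (v j) (lieact x (b (v j i)))) => [|i'' ii'];
    rewrite ?dfwith_in // !dfwith_out.
Qed.

End Slots.

Definition mix n (y v : forall i, V i) : forall i, V i :=
  fun i => if (i < n)%N then y i else v i.

Lemma mixS_dfwith n (i : 'I_m) (y v : forall i, V i) (z : V i) : i = n :> nat ->
  mix n.+1 (dfwith y z) v = dfwith (mix n y v) z.
Proof.
move=> i_n; apply: functional_extensionality_dep => j; rewrite /mix ltnS.
case: (dfwithP y z) => [|i' ii']; first by rewrite dfwith_in i_n leqnn.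
rewrite dfwith_out // /mix leq_eqVlt -i_n.
by rewrite (inj_eq val_inj) eq_sym (negPf ii').
Qed.

(* Slots [< n] are free. Isolating one coefficient of [v j n] at a time frees
   slot [n]; once all slots are free, [\sum_j l j] lies in [absorbed]. *)
Lemma free_slots (J : finType) (v : J -> forall i, V i) (d : nat) (l : J -> L) :
    (d <= m)%N ->
    (forall y, M (\sum_j tau (tauE (mix (m - d) y (v j))) (l j))) ->
  forall y, tensor_sub tau absorbed
    (\sum_j tau (tauE (mix (m - d) y (v j))) (l j)).
Proof.
(* [d] counts the slots not yet free. [l] is generalised because freeing a slot rescales the
   [l j]. *)
elim: d l => [|d IH] l dm Ml y.
  have mixm w z : mix m w z = w.
    by apply: functional_extensionality_dep => i; rewrite /mix ltn_ord.
  have sumE w : \sum_j tau (tauE (mix (m - 0) w (v j))) (l j) =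
      tau (tauE w) (\sum_j l j).
    under eq_bigr do rewrite subn0 mixm.
    by rewrite (linear_fun_sum (tau_linr _)).
  rewrite sumE => W _; apply; exists (tauE y), (\sum_j l j); split=> // e.
  (* [S] contains all pure tensors of [E], hence is all of [E]. *)
  pose S := [set e | M (tau e (\sum_j l j))].
  suff SE : S = [set: E] by have : S e by rewrite SE.
  have [E_tensor _ _] := E_eval.
  apply: tensor_product_span E_tensor _ _ => [|w]; last by rewrite /S /= -sumE.
  split=> [|c e1 e2 Se1 Se2]; rewrite /S /=.
    by rewrite (linear_fun0 (tau_linl _)); case: M_subspace.
  by rewrite tau_linl; case: M_subspace => _; apply.
have nm : (m - d.+1 < m)%N by rewrite ltn_subrL (leq_trans _ dm).
have nE : (m - d = (m - d.+1).+1)%N by rewrite subnSK.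
set n := (m - d.+1)%N in nm nE Ml *; pose i := Ordinal nm.
have mix_i w z : mix n w z i = z i by rewrite /mix ltnn.
have [N [u [c [cE c_iso]]]] :=
  enveloping_isolates (@V_irr i) [seq v j i | j : J] F_unc.
have vi j : v j i \in [seq v j i | j : J] by apply: map_f; rewrite mem_enum.
(* Expand slot [n] of each [v j] in the [u k] and move the coefficients onto [l j]; for each [k],
   slot [n] then holds a vector independent of [j]. *)
have -> : \sum_j tau (tauE (mix n y (v j))) (l j) = \sum_(k < N)
    \sum_j tau (tauE (mix (m - d) (dfwith y (u k)) (v j))) (c (v j i) k *: l j).
  rewrite exchange_big; apply: eq_bigr => j _.
  rewrite -{1}(dfwith_id i (mix n y (v j))) mix_i {1}(cE _ (vi j)).
  rewrite (linear_fun_sum (@tauE_lin _ _)) (linear_fun_sum (tau_linl _)).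
  apply: eq_bigr => k _; rewrite nE mixS_dfwith //.
  rewrite (linear_funZ (@tauE_lin _ _)) (linear_funZ (tau_linl _)).
  by rewrite (linear_funZ (tau_linr _)).
apply: subspace_sum absorbed_subspace _ => k _.
apply: (IH (fun j => c (v j i) k *: l j)); first exact: ltnW.
(* Applied in slot [n], [b] turns [v j i] into [c (v j i) k *: z i], so [M] contains the [k]-th sum
   with an arbitrary vector there. *)
move=> z; have [b benv bE] := c_iso k (z i).
have := slot_enveloping benv (Ml z); congr M; apply: eq_bigr => j _.
rewrite mix_i bE // (linear_funZ (@tauE_lin _ _)) (linear_funZ (tau_linl _)).
by rewrite (linear_funZ (tau_linr _)) -(@mixS_dfwith n) // dfwith_id nE.
Qed.

Lemma pure_tensor_sum (t : T) : exists (r : nat)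
    (v : 'I_r -> forall i, V i) (l : 'I_r -> L),
  t = \sum_j tau (tauE (v j)) (l j).
Proof.
pose S := [set t : T | exists s : seq ((forall i, V i) * L),
  t = \sum_(p <- s) tau (tauE p.1) p.2].
suff ST : S = [set: T].
  have [s ->] : S t by rewrite ST.
  exists (size s), (fun j => (tnth (in_tuple s) j).1),
    (fun j => (tnth (in_tuple s) j).2).
  by rewrite big_tnth.
have S_sub : is_subspace S.
  split=> [|c _ _ [s1 ->] [s2 ->]]; first by exists [::]; rewrite big_nil.
  (* Scalars are absorbed into the factor from [L], so no coefficients are needed. *)
  exists ([seq (p.1, c *: p.2) | p <- s1] ++ s2); rewrite big_cat big_map.
  rewrite scaler_sumr; congr (_ + _); apply: eq_bigr => p _ /=.
  by rewrite (linear_funZ (tau_linr _)).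
have [T_prod _] := T_tensor; have [E_prod _ _] := E_eval.
apply: (tensor_product2_span T_prod) => // e l.
pose SE := [set e | S (tau e l)].
suff SEE : SE = [set: E] by have : SE e by rewrite SEE.
apply: (tensor_product_span E_prod) => [|v].
  split=> [|c e1 e2 S1 S2]; rewrite /SE /=.
    by rewrite (linear_fun0 (tau_linl _)); case: S_sub.
  by rewrite tau_linl; case: S_sub => _; apply.
by exists [:: (v, l)]; rewrite big_seq1.
Qed.

Lemma submodule_tensor_sub : M = tensor_sub tau absorbed.
Proof.
apply/seteqP; split; last exact: absorbed_sub.
move=> t Mt; have [r [v [l tE]]] := pure_tensor_sum t.
have mix0 y w : mix (m - m) y w = w.
  by rewrite subnn; apply: functional_extensionality_dep.
have sumE y : \sum_j tau (tauE (mix (m - m) y (v j))) (l j) = t.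
  by rewrite tE; apply: eq_bigr => j _; rewrite mix0.
(* Start with [d = m]: no slot is free yet, so any [y] serves and the hypothesis reduces to
   [M t]. *)
rewrite -(sumE (fun=> 0)); apply: free_slots => // y.
by rewrite sumE.
Qed.

End EvaluationTensor.

Theorem theorem3p3 (R : realType) (g : finLieAlgType R[i])
    (h : {vspace g}) (D : seq (hdual h))
    (g_simple : simple_lie g)
    (h_cartan : cartan_subalgebra h)
    (D_base : root_base D)
    (L : lieModType (affine g))
    (L_smooth : smooth_module L)
    (m : nat) (m_gt0 : (0 < m)%N)
    (a : 'I_m -> R[i])
    (a_neq0 : forall i, a i != 0)
    (a_inj : injective a)
    (la : 'I_m -> hdual h)
    (V : 'I_m -> lieModType g)
    (V_la : forall i, irreducible_highest_weight D (la i) (V i))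
    (E : lieModType (affine g)) (tauE : (forall i, V i) -> E)
    (E_eval : is_evaluation_module a tauE)
    (T : lieModType (affine g)) (tau : E -> L -> T)
    (T_tensor : is_tensor_module tau)
    (M : set T) (M_sub : is_submodule M) :
  exists N : set L, is_submodule N /\ M = tensor_sub tau N.
Proof.
have V_irr i : irreducible_module (V i) by case: (V_la i).
exists (absorbed tau M); split; first exact: absorbed_submodule.
exact: (submodule_tensor_sub (@complex_uncountable R) L_smooth a_neq0 a_inj
  V_irr E_eval).
Qed.
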